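(* Let $A$ be a single-agent online exploration algorithm for unicyclic graphs which, for every unicyclic graph $G$ and start node $s$, explores $G$ with cost at most $3\cdot opt(G,s,1)$. Then for every $n$ and every $n$-tadpole graph $G$ with start node $s$, exploring $G$ with a single agent running $A$ has cost at most $12\cdot opt(G,s,2)$, where $opt(G,s,2)$ is the optimal offline cost using two agents. This holds in the time model as well as in the energy model.
   Context: Online graph exploration: an undirected connected graph $G=(V,E)$ with positive edge lengths $l(e)$ and distinctly labelled nodes is initially unknown. Agents start at a node $s$; initially they know $s$, its incident edges (with lengths) and its neighbours. Whenever an agent visits a node $v$ for the first time, all edges incident to $v$ (with lengths) and the neighbours of $v$ are revealed. Agents share all information instantly, move at unit speed (traversing $e$ takes time $l(e)$), and may wait. The exploration is finished when every node has been visited and all agents are back at $s$. Time model: cost is the finishing time. Energy model: cost is the maximum total distance travelled by any single agent. $opt(G,s,k)$ is the minimum cost of an exploration by $k$ agents with full prior knowledge of $G$. A unicyclic graph is a connected graph containing exactly one cycle. An $n$-tadpole graph consists of a cycle to which $n$ tails (paths, each with at least one edge, attached at one endpoint to a cycle node) are attached; several tails may be attached to the same cycle node. Every $n$-tadpole graph is unicyclic. *)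

(* Defs.v *)
From HB Require Import structures.
From mathcomp Require Import all_boot all_order all_algebra.
From mathcomp Require Import classical_sets reals.

Set Implicit Arguments.
Unset Strict Implicit.
Unset Printing Implicit Defensive.

Import Order.TTheory GRing.Theory Num.Theory.
Local Open Scope ring_scope.

Record lgraph (R : realType) := LGraph {
  node :> finType;
  adj : rel node;
  adj_sym : symmetric adj;
  adj_irr : irreflexive adj;
  (* [len u v] is only meaningful when [adj u v] *)
  len : node -> node -> R;
  len_sym : forall u v, len u v = len v u;
  len_gt0 : forall u v, adj u v -> 0 < len u v;
  label : node -> nat;
  label_inj : injective label
}.

Section GraphClasses.
Variables (R : realType) (G : lgraph R).

Definition edges : {set {set G}} :=
  [set [set e.1; e.2] | e in [pred e : G * G | adj e.1 e.2]].

Definition cycle_edges (c : seq G) : {set {set G}} :=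
  [set [set x; next c x] | x in c].

Definition path_edges (x : G) (p : seq G) : {set {set G}} :=
  [set [set e.1; e.2] | e in zip (x :: p) p].

Definition connected : Prop := forall u v : G, connect (@adj R G) u v.

(* Cycles are identified with their edge sets, so that rotating or reversing
   the node sequence does not produce a different cycle. *)
Definition is_cycle (C : {set {set G}}) : Prop :=
  exists c : seq G,
    [/\ ucycle (@adj R G) c, (2 < size c)%N & C = cycle_edges c].

Definition unicyclic : Prop := connected /\ exists! C, is_cycle C.

(* [c] lists the nodes of the cycle; the [i]-th tail is the path
   [a i :: t i], of which only the endpoint [a i] lies on the cycle. *)
Definition tadpole (n : nat) : Prop :=
  exists (c : seq G) (a : 'I_n -> G) (t : 'I_n -> seq G),
  let nodes := c ++ flatten [seq t i | i : 'I_n] in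
  [/\ (2 < size c)%N,
      forall i, a i \in c /\ t i != [::],
      uniq nodes,
      forall v : G, v \in nodes
    & edges = cycle_edges c :|: \bigcup_(i < n) path_edges (a i) (t i)].

End GraphClasses.

Inductive cost_model := TimeModel | EnergyModel.

(* [T] is the type of nodes for the steps of a route in a given graph, and
   the type of labels for the commands issued by an online algorithm. *)
Inductive action (T R : Type) :=
  | Move of T
  | Wait of R.
Arguments Move {T R}.
Arguments Wait {T R}.

Section Exploration.
Variables (R : realType) (G : lgraph R).

Definition route := seq (action G R).

Definition move (u : G) (a : action G R) : G :=
  if a is Move v then v else u.

Definition positions (s : G) (r : route) : seq G := s :: scanl move s r.

Fixpoint legal (u : G) (r : route) : bool :=
  match r with
  | [::] => true
  | Move v :: r' => adj u v && legal v r'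
  | Wait t :: r' => (0 <= t) && legal u r'
  end.

Definition action_cost (m : cost_model) (u : G) (a : action G R) : R :=
  match a with
  | Move v => len u v
  | Wait t => if m is TimeModel then t else 0
  end.

Fixpoint route_cost (m : cost_model) (u : G) (r : route) : R :=
  if r is a :: r' then action_cost m u a + route_cost m (move u a) r' else 0.

Definition exploration (s : G) (k : nat) (rs : 'I_k -> route) : Prop :=
  [/\ forall i, legal s (rs i),
      forall i, foldl move s (rs i) = s
    & forall v : G, exists i, v \in positions s (rs i)].

(* An agent that is back at [s] early may remain there at no cost to the others,
   so the finishing time is the largest duration of a route. *)
Definition exploration_cost (m : cost_model) (s : G) (k : nat)
    (rs : 'I_k -> route) : R :=
  \big[Num.max/0]_(i < k) route_cost m s (rs i).

(* For a connected graph and [0 < k] this infimum is a minimum: edge lengths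
   are positive, so finitely many wait-free routes stay below a given cost. *)
Definition opt (m : cost_model) (s : G) (k : nat) : R :=
  inf [set c | exists2 rs : 'I_k -> route,
         exploration s rs & c = exploration_cost m s rs]%classic.

End Exploration.

(* The label of a node, and the map sending the label of each neighbour to the
   length of the connecting edge (and any other label to [None]). *)
Definition observation (R : realType) : Type := (nat * (nat -> option R))%type.

Definition observe (R : realType) (G : lgraph R) (v : G) : observation R :=
  (label v,
   fun x => omap (len v) [pick u | adj v u && (label u == x)]).

(* The next command is a function of the observations made so far, at the start
   and after each action; past commands can be recomputed from them.  Nothing
   else about the graph is available: neither [node G] nor its enumeration. *)
Definition online_algorithm (R : realType) : Type :=
  seq (observation R) -> action nat R.

Section Online.
Variables (R : realType) (A : online_algorithm R) (G : lgraph R).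

Definition command (a : action G R) : action nat R :=
  match a with Move v => Move (label v) | Wait t => Wait t end.

Definition history (s : G) (r : route G) : seq (observation R) :=
  [seq observe v | v <- positions s r].

Definition follows (s : G) (r : route G) : Prop :=
  forall r1 a r2, r = r1 ++ a :: r2 -> A (history s r1) = command a.

Definition finished (s : G) (r : route G) : Prop :=
  exploration s (fun _ : 'I_1 => r).

(* The run is cut at the first moment at which the exploration is finished.
   As [A] is deterministic and labels are distinct, [c] is unique. *)
Definition explores_with_cost (m : cost_model) (s : G) (c : R) : Prop :=
  exists r : route G,
    [/\ follows s r, finished s r,
        forall r1 a r2, r = r1 ++ a :: r2 -> ~ finished s r1
      & c = route_cost m s r].

End Online.

(* Main.v *)
Require Import Defs.
From mathcomp Require Import all_boot all_order all_algebra.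
From mathcomp Require Import classical_sets reals.
From mathcomp Require Import lra.

(** A single agent can run the two routes of a 2-agent exploration one after
    the other, since both are closed walks at [s]; hence
    [opt m s 1 <= 2 * opt m s 2], and [3 * 2 <= 12].  What remains is that a
    tadpole graph is unicyclic: the deepest node of a tail on a cycle would have
    its parent as both of its neighbours on that cycle, so every cycle stays
    within the nodes of [c], where each node has only two neighbours. *)

Set Implicit Arguments.
Unset Strict Implicit.
Unset Printing Implicit Defensive.

Import Order.TTheory GRing.Theory Num.Theory.
Local Open Scope ring_scope.

(** * Cyclic neighbours and positions in sequences *)

Section Sequences.
Local Open Scope nat_scope.

Lemma uniq_flatten_map_inj (I T : eqType) (t : I -> seq T) (s : seq I) :
  uniq (flatten (map t s)) ->
  {in s &, forall i j v, v \in t i -> v \in t j -> i = j}.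
Proof.
elim: s => [|k s IH] //=; rewrite cat_uniq => /and3P[_ /hasPn dis us].
have out l v : l \in s -> v \in t l -> v \notin t k.
  by move=> ls vl; apply: dis; apply/flatten_mapP; exists l.
move=> i j; rewrite !inE => /predU1P[->|si] /predU1P[->|sj] v vi vj //.
- by have := out _ _ sj vj; rewrite vi.
- by have := out _ _ si vi; rewrite vj.
- exact: IH us _ _ si sj _ vi vj.
Qed.

(** If the two cyclic neighbours of [x] agreed, two [next] steps would lead from [x] back to [x].
    Rotated to start at [x], the sequence reads [x, a, b, ...], so this would force [b = x], against
    [uniq p]. *)
Lemma next_neq_prev (T : eqType) (p : seq T) (x : T) :
  uniq p -> 2 < size p -> x \in p -> next p x != prev p x.
Proof.
move=> up sp xp; apply/eqP => eq_np.
have := next_prev up x; rewrite -eq_np.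
case: (rot_to xp) => i q def_q.
have := up; have := sp; rewrite -(rot_uniq i) -(size_rot i).
rewrite -!(next_rot i up) def_q.
case: q {def_q} => [|a [|b q]] //= _; rewrite !inE !negb_or !eqxx.
move=> /andP[/and3P[xa xb _] _].
by rewrite eq_sym (negPf xa) => /esym/eqP; rewrite (negPf xb).
Qed.

Lemma zip_behead_nth (T : eqType) (x : T) (p : seq T) (e : T * T) :
  e \in zip (x :: p) p ->
  exists2 k, k < size p & e = (nth x (x :: p) k, nth x p k).
Proof.
move=> /(nthP (x, x))[k]; rewrite size_zip /= (minn_idPr (leqnSn _)) => kp <-.
exists k => //; rewrite nth_zip_cond size_zip /= (minn_idPr (leqnSn _)) kp.
by [].
Qed.

End Sequences.

Lemma set2_eqP (T : finType) (a b x y : T) :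
  [set a; b] = [set x; y] -> (a = x /\ b = y) \/ (a = y /\ b = x).
Proof.
move=> E.
have : a \in [set x; y] by rewrite -E set21.
have : b \in [set x; y] by rewrite -E set22.
have : x \in [set a; b] by rewrite E set21.
have : y \in [set a; b] by rewrite E set22.
rewrite !inE => /pred2P hy /pred2P hx /pred2P hb /pred2P ha.
by case: hy; case: hx; case: hb; case: ha; intros; subst; auto.
Qed.

(** * Edges of cycles and paths as unordered pairs *)

Section Graph.
Variables (R : realType) (G : lgraph R).

Lemma mem_edges (u v : G) : ([set u; v] \in edges G) = adj u v.
Proof.
apply/imsetP/idP => [[[x y]]|uv]; last by exists (u, v).
by rewrite inE /= => xy /set2_eqP[] [-> ->] //; rewrite adj_sym.
Qed.

Lemma mem_cycle_edges (c : seq G) (u v : G) : uniq c ->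
  [set u; v] \in cycle_edges c ->
  [/\ u \in c, v \in c & v = next c u \/ v = prev c u].
Proof.
move=> uc /imsetP[x xc] /set2_eqP[] [-> ->]; split; rewrite ?mem_next //.
  by left.
by right; rewrite prev_next.
Qed.

Lemma path_of_path_edges (x : G) (p : seq G) :
  path_edges x p \subset edges G -> path (@adj R G) x p.
Proof.
move=> /fintype.subsetP sub; apply/(pathP x) => k kp; rewrite -mem_edges.
apply: sub; apply/imsetP; exists (nth x (x :: p) k, nth x p k) => //.
apply/(nthP (x, x)); exists k; first by rewrite size_zip /= (minn_idPr (leqnSn _)).
by rewrite nth_zip_cond size_zip /= (minn_idPr (leqnSn _)) kp.
Qed.

(** Orients a path edge away from the attachment point [x]: one endpoint is a child in [p], the
    other its parent. Prepending [x] shifts positions by one, so the parent stands in [x :: p] at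
    the index the child has in [p]. *)
Lemma mem_path_edges (x v w : G) (p : seq G) : uniq p ->
  [set v; w] \in path_edges x p ->
  (v \in p /\ w = nth x (x :: p) (index v p)) \/
  (w \in p /\ v = nth x (x :: p) (index w p)).
Proof.
move=> up /imsetP[e /zip_behead_nth[k kp ->]] /= /set2_eqP[] [-> ->].
  by right; rewrite mem_nth // index_uniq.
by left; rewrite mem_nth // index_uniq.
Qed.

End Graph.

(** * Uniqueness of the cycle and connectedness of a tadpole graph *)

Section Tadpole.
Variables (R : realType) (G : lgraph R) (n : nat).
Variables (c : seq G) (a : 'I_n -> G) (t : 'I_n -> seq G).
Hypotheses (c_gt2 : (2 < size c)%N) (a_c : forall i, a i \in c).
Hypothesis uniq_nodes : uniq (c ++ flatten [seq t i | i : 'I_n]).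
Hypothesis all_nodes : forall v, v \in c ++ flatten [seq t i | i : 'I_n].
Hypothesis edgesE :
  edges G = cycle_edges c :|: \bigcup_(i < n) path_edges (a i) (t i).

Lemma uniq_c : uniq c.
Proof. by have := uniq_nodes; rewrite cat_uniq => /and3P[]. Qed.

Lemma tail_notin_c i v : v \in t i -> v \notin c.
Proof.
move=> vi; have := uniq_nodes; rewrite cat_uniq => /and3P[_ /hasPn dis _].
by apply: dis; apply/flatten_mapP; exists i; rewrite ?mem_enum.
Qed.

Lemma tail_inj i j v : v \in t i -> v \in t j -> i = j.
Proof.
have := uniq_nodes; rewrite cat_uniq => /and3P[_ _ /uniq_flatten_map_inj inj].
by apply: inj; rewrite mem_enum.
Qed.

Lemma uniq_tail i : uniq (t i).
Proof.
have := uniq_nodes; rewrite cat_uniq /image_mem => /and3P[_ _].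
have : i \in enum 'I_n by rewrite mem_enum.
elim: (enum _) => [|j s IH] //=; rewrite inE => /predU1P[->|si].
  by rewrite cat_uniq => /and3P[].
by rewrite cat_uniq => /and3P[_ _]; apply: IH.
Qed.

Lemma node_cases v : v \in c \/ exists i, v \in t i.
Proof.
have := all_nodes v; rewrite mem_cat => /orP[vc|/flatten_mapP[i _ vi]].
  by left.
by right; exists i.
Qed.

Lemma adj_cases v w : adj v w ->
  [set v; w] \in cycle_edges c \/ exists i, [set v; w] \in path_edges (a i) (t i).
Proof.
rewrite -mem_edges edgesE inE => /orP[|/bigcupP[i _]]; first by left.
by right; exists i.
Qed.

(** A tail node lies off [c], so its edges are all path edges, in which it is either the child or
    the parent. The index in [t i] measures depth and grows from parent to child. *)
Lemma tail_parent_or_child i v w : v \in t i -> adj v w ->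
  w = nth (a i) (a i :: t i) (index v (t i)) \/
  (w \in t i /\ (index v (t i) < index w (t i))%N).
Proof.
move=> vi /adj_cases[/(mem_cycle_edges uniq_c)[vc]|[j]].
  by have := tail_notin_c vi; rewrite vc.
case/(mem_path_edges (uniq_tail j)) => [[vj ->]|[wj E]].
  by rewrite (tail_inj vi vj); left.
(* Here [v] is the parent of [w]. Index 0 for [w] would make [v] the attachment node [a j], which
   lies on [c]; otherwise [v] is the tail node just before [w]. *)
right; move: E wj; case E: (index w (t j)) => [|k] /= def_v wj.
  by have := tail_notin_c vi; rewrite def_v a_c.
have kj : (k < size (t j))%N.
  by apply: (@leq_trans k.+1) => //; rewrite -E index_size.
have vj : v \in t j by rewrite def_v mem_nth.
rewrite (tail_inj vi vj) wj; split=> //.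
by rewrite E def_v index_uniq ?uniq_tail.
Qed.

Lemma cycle_next_adj (d : seq G) x :
  ucycle (@adj R G) d -> x \in d -> adj x (next d x) /\ adj x (prev d x).
Proof.
move=> /andP[cd ud] xd; split; first exact: next_cycle.
by rewrite adj_sym; apply: prev_cycle.
Qed.

Lemma ucycle_sub_c (d : seq G) :
  ucycle (@adj R G) d -> (2 < size d)%N -> {subset d <= c}.
Proof.
move=> cyc_d d_gt2 x xd; case: (node_cases x) => // -[i xi].
pose P v := (v \in d) && (v \in t i).
have Px : P x by rewrite /P xd.
(* [v] is the deepest node of tail [i] on [d]; maximality excludes a child of [v] on [d]. *)
case: (arg_maxnP (fun v => index v (t i)) Px) => v /andP[vd vi] v_max.
have [adj_n adj_p] := cycle_next_adj cyc_d vd.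
have par w : w \in d -> adj v w -> w = nth (a i) (a i :: t i) (index v (t i)).
  move=> wd /(tail_parent_or_child vi)[//|[wi]].
  by rewrite ltnNge => /negP[]; apply: v_max; rewrite /P wd.
have /andP[_ ud] := cyc_d.
have := next_neq_prev ud d_gt2 vd.
have nd : next d v \in d by rewrite mem_next.
have pd : prev d v \in d by rewrite mem_prev.
by rewrite (par _ nd adj_n) (par _ pd adj_p) eqxx.
Qed.

(** Every tail edge has an endpoint off [c], so an edge between two nodes of [c] is a cycle edge. *)
Lemma adj_in_c v w : v \in c -> w \in c -> adj v w ->
  w = next c v \/ w = prev c v.
Proof.
move=> vc wc /adj_cases[/(mem_cycle_edges uniq_c)[]//|[i]].
by case/(mem_path_edges (uniq_tail i)) => -[/tail_notin_c]; rewrite ?vc ?wc.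
Qed.

(** The two neighbours of [x] on [d] are distinct and both lie among the two candidates [next c x]
    and [prev c x], so they exhaust them. *)
Lemma ucycle_next (d : seq G) x :
  ucycle (@adj R G) d -> (2 < size d)%N -> x \in d ->
  next c x = next d x \/ next c x = prev d x.
Proof.
move=> cyc_d d_gt2 xd; have sub := ucycle_sub_c cyc_d d_gt2.
have [adj_n adj_p] := cycle_next_adj cyc_d xd.
have /andP[_ ud] := cyc_d; have := next_neq_prev ud d_gt2 xd.
have nc : next d x \in c by rewrite sub ?mem_next.
have pc : prev d x \in c by rewrite sub ?mem_prev.
case: (adj_in_c (sub _ xd) nc adj_n) => [|->]; first by left.
by case: (adj_in_c (sub _ xd) pc adj_p) => ->; [right | rewrite eqxx].
Qed.

Lemma c_sub_ucycle (d : seq G) :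
  ucycle (@adj R G) d -> (2 < size d)%N -> {subset c <= d}.
Proof.
move=> cyc_d d_gt2 y yc; have sub := ucycle_sub_c cyc_d d_gt2.
have [x xd] : exists x, x \in d.
  by case: (d) d_gt2 => // x q _; exists x; rewrite mem_head.
(* Any [y] in [c] is reached from [x] by iterating [next c], and each such step stays inside [d]. *)
have := connect_cycle (cycle_next uniq_c) (sub _ xd) yc.
move/iter_findex => <-; elim: findex => //= k IH.
by case: (ucycle_next cyc_d d_gt2 IH) => ->; rewrite ?mem_next ?mem_prev.
Qed.

Lemma ucycle_edges_eq (d : seq G) :
  ucycle (@adj R G) d -> (2 < size d)%N -> cycle_edges c = cycle_edges d.
Proof.
move=> cyc_d d_gt2; have /andP[_ ud] := cyc_d.
apply/setP/fintype.subset_eqP/andP; split; apply/fintype.subsetP => e /imsetP[x xe ->].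
  have xd := c_sub_ucycle cyc_d d_gt2 xe.
  case: (ucycle_next cyc_d d_gt2 xd) => ->; first by exact: (imset_f (fun y => [set y; _ y])).
  (* When [c] runs through [x] against the direction of [d], the edge is listed in [cycle_edges d]
     under its other endpoint. *)
  apply/imsetP; exists (prev d x); first by rewrite mem_prev.
  by rewrite next_prev // finset.setUC.
have sub := ucycle_sub_c cyc_d d_gt2.
have nc : next d x \in c by rewrite sub ?mem_next.
have [adj_n _] := cycle_next_adj cyc_d xe.
have xc := sub _ xe.
case: (adj_in_c xc nc adj_n) => ->; first by exact: (imset_f (fun y => [set y; _ y])).
apply/imsetP; exists (prev c x); first by rewrite mem_prev.
by rewrite next_prev ?uniq_c // finset.setUC.
Qed.

Lemma ucycle_c : ucycle (@adj R G) c.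
Proof.
apply/andP; split; last exact: uniq_c.
apply: cycle_from_next => [|x xc]; first exact: uniq_c.
rewrite -mem_edges edgesE inE; apply/orP; left.
exact: (imset_f (fun y => [set y; next c y])).
Qed.

Lemma tadpole_connected : connected G.
Proof.
have sym : connect_sym (@adj R G).
  by apply: sym_connect_sym; apply: adj_sym.
have [z zc] : exists z, z \in c.
  by case: (c) c_gt2 => // z q _; exists z; rewrite mem_head.
have from_c y : y \in c -> connect (@adj R G) z y.
  by move=> yc; have /andP[cyc _] := ucycle_c; apply: connect_cycle zc yc.
have from_z v : connect (@adj R G) z v.
  case: (node_cases v) => [|[i vi]]; first exact: from_c.
  (* A tail node is reached through the attachment node of its tail. *)
  apply: connect_trans (from_c _ (a_c i)) _.
  have pth : path (@adj R G) (a i) (t i).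
    apply: path_of_path_edges; rewrite edgesE subsetU //; apply/orP; right.
    exact: finset.bigcup_sup.
  by apply: path_connect pth _ _; rewrite inE vi orbT.
by move=> u v; apply: connect_trans (from_z v); rewrite sym.
Qed.

End Tadpole.

Lemma tadpole_unicyclic (R : realType) (G : lgraph R) (n : nat) :
  tadpole G n -> unicyclic G.
Proof.
case=> c [a [t [c_gt2 ha un all_n eE]]].
have a_c i : a i \in c by case: (ha i).
split; first exact: tadpole_connected c_gt2 a_c un all_n eE.
exists (cycle_edges c); split.
  by exists c; split=> //; apply: ucycle_c un eE.
move=> _ [d [cyc_d d_gt2 ->]].
exact: (ucycle_edges_eq a_c un all_n eE cyc_d d_gt2).
Qed.

(** * Costs of routes and of optimal explorations *)

Section Routes.
Variables (R : realType) (m : cost_model) (G : lgraph R).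
Implicit Types (u s : G) (r : route G).

Lemma route_cost_ge0 u r : legal u r -> 0 <= route_cost m u r.
Proof.
elim: r u => //= -[v|x] r IH u /andP[h /IH] ?; rewrite addr_ge0 //=.
  exact: ltW (len_gt0 h).
by case: m.
Qed.

Lemma route_cost_cat u r1 r2 : route_cost m u (r1 ++ r2) =
  route_cost m u r1 + route_cost m (foldl (@move R G) u r1) r2.
Proof. by elim: r1 u => [|x r IH] u /=; rewrite ?add0r // IH addrA. Qed.

Lemma legal_cat u r1 r2 :
  legal u (r1 ++ r2) = legal u r1 && legal (foldl (@move R G) u r1) r2.
Proof. by elim: r1 u => [|[v|x] r IH] u //=; rewrite IH andbA. Qed.

Lemma exploration_cost_ge0 s k (rs : 'I_k -> route G) :
  0 <= exploration_cost m s rs.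
Proof.
rewrite /exploration_cost; elim/big_rec: _ => // i x _ x0.
by rewrite le_max x0 orbT.
Qed.

Lemma route_cost_le_max s k (rs : 'I_k -> route G) i :
  route_cost m s (rs i) <= exploration_cost m s rs.
Proof. exact: le_bigmax (fun j => route_cost m s (rs j)) i. Qed.

Lemma opt_le s k (rs : 'I_k -> route G) :
  exploration s rs -> opt m s k <= exploration_cost m s rs.
Proof.
move=> ex; apply: ge_inf; last by exists rs.
(* The infimum bounds its elements from below only once the set is known to have a lower bound; 0 is
   one. *)
by exists 0 => _ [rs' _ ->]; apply: exploration_cost_ge0.
Qed.

Lemma exploration_serialize s (rs : 'I_2 -> route G) :
  exploration s rs ->
  exploration s (fun _ : 'I_1 => rs ord0 ++ rs ord_max).
Proof.
move=> [leg back vis]; split.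
- by move=> _; rewrite legal_cat back !leg.
- by move=> _; rewrite foldl_cat !back.
move=> v; exists ord0; rewrite /positions scanl_cat back -/(positions _ _).
case: (vis v) => i; rewrite /positions !inE mem_cat.
have [->|->] : i = ord0 \/ i = ord_max.
  by case: i => -[|[|k]] // lti; [left | right]; apply: val_inj.
- by case/orP => ->; rewrite ?orbT.
- by case/orP => ->; rewrite ?orbT.
Qed.

(** The serialised route costs the sum of two routes, each at most their maximum. The route [r]
    ensures that [opt m s 2] is the infimum of a nonempty set: both agents may run [r]. *)
Lemma opt1_le_double_opt2 s r : finished s r -> opt m s 1 <= 2 * opt m s 2.
Proof.
move=> [leg back vis].
rewrite -ler_pdivrMl //; apply: lb_le_inf.
  exists (exploration_cost m s (fun _ : 'I_2 => r)), (fun _ => r) => //.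
  split=> [i|i|v]; [exact: leg ord0 | exact: back ord0 |].
  by case: (vis v) => _ vr; exists ord0.
move=> _ [rs ex ->]; rewrite ler_pdivrMl //.
apply: le_trans (opt_le (exploration_serialize ex)) _.
rewrite {1}/exploration_cost big_ord_recl big_ord0.
case: ex => legs backs _.
(* The maximum over one agent still includes the base value 0; it drops out because route costs are
   nonnegative. *)
rewrite route_cost_cat backs max_l.
  by rewrite mulr_natl mulr2n lerD ?route_cost_le_max.
by rewrite addr_ge0 ?route_cost_ge0.
Qed.

End Routes.

Theorem theorem11 (R : realType) (A : online_algorithm R) (m : cost_model)
    (hA : forall (G : lgraph R) (s : G), unicyclic G ->
       exists2 c : R, explores_with_cost A m s c & c <= 3 * opt m s 1) :
  forall (n : nat) (G : lgraph R) (s : G), tadpole G n ->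
    exists2 c : R, explores_with_cost A m s c & c <= 12 * opt m s 2.
Proof.
move=> n G s /tadpole_unicyclic uG.
have [x x_cost x_le] := hA G s uG; exists x => //.
case: x_cost => r [_ fin _ x_def].
have h12 := opt1_le_double_opt2 m fin.
(* The bounds so far give [x <= 6 * opt m s 2]. Nonnegativity of [x] makes [opt m s 2] nonnegative,
   so that 6 may be weakened to 12. *)
have x_ge0 : 0 <= x.
  by rewrite x_def route_cost_ge0 //; case: fin => /(_ ord0).
lra.
Qed.
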